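(* Let $q\ge 2$ be a prime power and $N\ge 2$ an integer. Fix a polynomial $A\in\mathcal{M}_N$. For any integers $0\le h\le N-1$ and $d\ge 0$, $$\big|\{F\in\mathcal{M}_N:\ \deg(F-A)\le h,\ P^+(F)\le d\}\big|\ \le\ \big|\{F\in\mathcal{M}_{h+1}:\ P^+(F)\le d\}\big|.$$
   Context: $\mathcal{M}_n$ is the set of monic polynomials of degree $n$ in $\mathbb{F}_q[t]$, and $P^+(F):=\max\{\deg P: P\mid F,\ P\text{ monic irreducible}\}$. The zero polynomial is regarded as having degree $\le h$ for every $h$. *)

(* Defs.v *)
From HB Require Import structures.
From mathcomp Require Import all_boot all_algebra all_field.

Set Implicit Arguments.
Unset Strict Implicit.
Unset Printing Implicit Defensive.

Import GRing.Theory.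
Local Open Scope ring_scope.

Section Defs.
Variable K : finFieldType.

(* M_n.  Having degree n means having size n.+1, so M_n lives in the finite
   type {poly_n.+1 K} of polynomials of degree at most n. *)
Definition monic_deg (n : nat) : {set {poly_n.+1 K}} :=
  [set F : {poly_n.+1 K} | (polyn F \is monic) && (size F == n.+1)%N].

(* P^+(F), for F != 0.  Every divisor of such an F has size at most size F, so
   ranging over {poly_(size F) K} loses nothing (see Pplus_leP).  The maximum
   is 0 if F is a nonzero constant; the value at F = 0 is meaningless. *)
Definition Pplus (F : {poly K}) : nat :=
  \max_(P : {poly_(size F) K} |
        [&& polyn P \is monic, irreducibleb P & polyn P %| F]) (size P).-1.

Lemma Pplus_leP (F : {poly K}) (d : nat) : F != 0 ->
  (Pplus F <= d)%N <->
  (forall P : {poly K}, P \is monic -> irreducible_poly P -> P %| F ->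
     ((size P).-1 <= d)%N).
Proof.
move=> F0; split.
  move/bigmax_leqP=> h P mP iP dP.
  have sP : (size P <= size F)%N by apply: dvdp_leq.
  apply: (h (NPoly sP)) => /=; apply/and3P; split=> //.
  exact/irreducibleP.
move=> h; apply/bigmax_leqP => P /and3P[mP /irreducibleP iP dP].
exact: h.
Qed.

End Defs.

(* Main.v *)
Require Import Defs.
From mathcomp Require Import all_boot all_algebra all_field.

Set Implicit Arguments.
Unset Strict Implicit.
Unset Printing Implicit Defensive.

Import GRing.Theory.
Local Open Scope ring_scope.

(** Order the monic irreducibles compatibly with the degree.  For an initial
    segment L of this order, we bound the number of L-smooth elements of a
    short interval of dimension n (a family of polynomials whose pairwise
    differences have degree < n) by the number of L-smooth monic polynomials of
    degree n.  Let p be the last element of L.  If deg p > n, every monic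
    polynomial of degree n is L-smooth and the bound is trivial.  If
    deg p <= n, then on both sides the L-smooth polynomials are the ones that
    are smooth for L minus p, together with the multiples pG; here G is
    L-smooth, and lies in an interval of dimension n - deg p (resp. is monic of
    degree n - deg p), so that induction applies. *)

Lemma monic_irreducible_dvd_ex (K : finFieldType) (F : {poly K}) :
  (1 < size F)%N ->
  exists P : {poly K}, [/\ P \is monic, irreducible_poly P & P %| F].
Proof.
have [m] := ubnP (size F); elim: m F => // m IHm F ltFm gt1F.
have F0 : F != 0 by rewrite -size_poly_gt0 ltnW.
have [irrF|] := boolP (irreducibleb F).
  exists ((lead_coef F)^-1 *: F).
  have c0 : (lead_coef F)^-1 != 0 by rewrite invr_eq0 lead_coef_eq0.
  split; last by rewrite dvdpZl.
    by rewrite monicE lead_coefZ mulVf ?lead_coef_eq0.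
  have /irreducibleP[_ irr] := irrF.
  split; first by rewrite size_scale.
  move=> Q Q1 QF; rewrite (eqp_rtrans (eqp_scale _ c0)).
  by apply: irr => //; rewrite -(dvdpZr _ _ c0).
(* [irreducibleb] quantifies over polynomials of size below that of [F], so its failure yields a
   proper nonconstant divisor [G]. *)
rewrite /irreducibleb gt1F => /forallPn[G]; rewrite negb_imply -ltnNge.
case/andP => GF gt1G.
have ltGF : (size G < size F)%N.
  by apply: leq_ltn_trans (size_npoly G) _; rewrite ltn_predL ltnW.
have [P [mP iP PG]] := IHm G (leq_trans ltGF ltFm) gt1G.
by exists P; split=> //; apply: dvdp_trans PG _; rewrite dvdpE.
Qed.

(** The allowed primes form a list rather than being cut off by degree, so that an induction can
    drop a single prime. *)
Definition smooth (K : fieldType) (L : seq {poly K}) (F : {poly K}) : Prop :=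
  forall P, P \is monic -> irreducible_poly P -> P %| F -> P \in L.

Lemma smooth_dvd (K : fieldType) (L : seq {poly K}) (F G : {poly K}) :
  G %| F -> smooth L F -> smooth L G.
Proof. by move=> GF sF P mP iP PG; apply: sF => //; apply: dvdp_trans GF. Qed.

Lemma irreducible_dvd_mul (K : fieldType) (P F G : {poly K}) :
  irreducible_poly P -> P %| F * G -> (P %| F) || (P %| G).
Proof.
move=> iP; have [//|nPF] := boolP (P %| F).
by rewrite Gauss_dvdpr // irreducible_poly_coprime.
Qed.

Lemma monic_irreducible_dvd_eq (K : fieldType) (P Q : {poly K}) :
  P \is monic -> Q \is monic -> irreducible_poly P -> irreducible_poly Q ->
  P %| Q -> P = Q.
Proof.
move=> mP mQ [gt1P _] [_ iQ] PQ; apply/eqP; rewrite -eqp_monic //.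
by apply: iQ => //; rewrite neq_ltn gt1P orbT.
Qed.

(** Elements of [s] share all coefficients from index [n] on, so replacing this common part by
    ['X^n] is injective. This settles the cases where smoothness imposes no condition in degree
    [n]. *)
Lemma monic_truncation_inj (K : fieldType) (n : nat) (s : seq {poly K}) :
  uniq s -> {in s &, forall F G : {poly K}, (size (F - G)%R <= n)%N} ->
  exists t : seq {poly K}, [/\ uniq t,
    {in t, forall T : {poly K}, T \is monic /\ size T = n.+1} &
    size s = size t].
Proof.
move=> us ds; exists [seq 'X^n + take_poly n F | F <- s]; split.
- rewrite map_inj_in_uniq // => F G Fs Gs /addrI eqFG; apply/eqP.
  rewrite -subr_eq0 -(@take_poly_id _ n (F - G)) ?ds //.
  by rewrite raddfB /= eqFG subrr.
- move=> _ /mapP[F _ ->].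
  have ltn : (size (take_poly n F) < size ('X^n : {poly K}))%N.
    by rewrite size_polyXn ltnS size_take_poly.
  by rewrite monicE lead_coefDl // lead_coefXn size_polyDl // size_polyXn.
- by rewrite size_map.
Qed.

(* [L] is listed by decreasing degree, so the last element p of the order is its
   head. *)
Lemma smooth_interval_bound (K : finFieldType) (L : seq {poly K}) (n : nat)
    (s : seq {poly K}) :
  uniq L -> sorted (fun P Q : {poly K} => size Q <= size P)%N L ->
  {in L, forall P : {poly K}, P \is monic /\ irreducible_poly P} ->
  (forall P Q : {poly K}, P \in L -> Q \is monic -> irreducible_poly Q ->
     (size Q < size P)%N -> Q \in L) ->
  uniq s ->
  {in s, forall F : {poly K}, [/\ F \is monic, (n < size F)%N & smooth L F]} ->
  {in s &, forall F G : {poly K}, (size (F - G)%R <= n)%N} ->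
  exists t : seq {poly K}, [/\ uniq t,
    {in t, forall T : {poly K}, [/\ T \is monic, size T = n.+1 & smooth L T]} &
    (size s <= size t)%N].
Proof.
elim: L n s => [|p L IHL] n s uL sL irrL downL us Ps ds.
  (* With no prime allowed, only nonzero constants are smooth: [s] is empty for positive [n], and
     for [n = 0] truncation applies. *)
  case: n Ps ds => [|n] Ps ds; last first.
    case: s us Ps {ds} => [|F s] _ Ps; first by exists [::].
    have [_ ltF sF] := Ps F (mem_head _ _).
    have [|P [mP iP PF]] := @monic_irreducible_dvd_ex _ F.
      by apply: leq_ltn_trans ltF.
    by have := sF P mP iP PF.
  have [t [ut Pt ->]] := monic_truncation_inj us ds.
  exists t; split=> // T /Pt[mT sT]; split=> // P mP [gt1P _] PT.
  have := dvdp_leq (monic_neq0 mT) PT.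
  by rewrite sT leqNgt gt1P.
have [mp ip] := irrL p (mem_head _ _).
have [gt1p _] := ip; have p0 := monic_neq0 mp.
have /andP[pL uL'] := uL.
have trL : transitive (fun P Q : {poly K} => size Q <= size P)%N.
  by move=> y x z yx zy; apply: leq_trans zy yx.
have sL' := path_sorted sL.
have leL Q : Q \in L -> (size Q <= size p)%N.
  by move=> QL; have /allP := order_path_min trL sL; apply.
have irrL' : {in L, forall P : {poly K}, P \is monic /\ irreducible_poly P}.
  by move=> P PL; apply: irrL; rewrite inE PL orbT.
(* The head [p] has maximal degree, so a prime of degree below that of some element of the tail
   cannot be [p]. *)
have downL' P Q : P \in L -> Q \is monic -> irreducible_poly Q ->
    (size Q < size P)%N -> Q \in L.
  move=> PL mQ iQ ltQP.
  have : Q \in p :: L by apply: downL ltQP => //; rewrite inE PL orbT.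
  rewrite inE => /predU1P[Qp|//].
  by move: ltQP; rewrite Qp ltnNge leL.
(* Inner induction on [n] with [p :: L] fixed: after division by [p], the cofactor may still be
   divisible by [p]. *)
have [m] := ubnP n; elim: m n s us Ps ds => // m IHm n s us Ps ds ltnm.
have [lepn|ltnp] := leqP (size p) n.+1; last first.
  have [t [ut Pt ->]] := monic_truncation_inj us ds.
  exists t; split=> // T /Pt[mT sT]; split=> // P mP iP PT.
  (* A prime factor of [T] has degree at most [n], hence below that of [p]. *)
  apply: (downL p) => //; first exact: mem_head.
  by apply: leq_ltn_trans ltnp; rewrite -sT dvdp_leq ?monic_neq0.
pose e := (size p).-1.
have ep : size p = e.+1 by rewrite /e prednK // ltnW.
have e_gt0 : (0 < e)%N by rewrite -ltnS -ep.
have len : (e <= n)%N by rewrite -ltnS -ep.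
pose s1 := [seq F %/ p | F <- s & p %| F].
pose s2 := [seq F <- s | ~~ (p %| F)].
have size_s : size s = (size s1 + size s2)%N.
  by rewrite size_map !size_filter count_predC.
have size_pM G : G != 0 -> size (p * G) = (e + size G)%N.
  by move=> G0; rewrite size_mul // ep addSn.
have s1P G : G \in s1 -> p * G \in s.
  case/mapP=> F; rewrite mem_filter => /andP[pF Fs] ->.
  by rewrite mulrC divpK.
have [t2 [ut2 Pt2 le2]] : exists t : seq {poly K}, [/\ uniq t,
    {in t, forall T : {poly K}, [/\ T \is monic, size T = n.+1 & smooth L T]} &
    (size s2 <= size t)%N].
  apply: IHL => //; first exact: filter_uniq.
    move=> F; rewrite mem_filter => /andP[npF Fs].
    have [mF nF sF] := Ps F Fs; split=> // P mP iP PF.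
    have := sF P mP iP PF; rewrite inE => /predU1P[Pp|//].
    by rewrite -Pp PF in npF.
  move=> F G; rewrite !mem_filter => /andP[_ Fs] /andP[_ Gs]; exact: ds.
(* Cancelling [p] lowers the bound on differences from [n] to [n - e], which is a smaller instance
   because [e] is positive. *)
have [t1 [ut1 Pt1 le1]] : exists t : seq {poly K}, [/\ uniq t,
    {in t, forall T : {poly K}, [/\ T \is monic, size T = (n - e).+1
      & smooth (p :: L) T]} &
    (size s1 <= size t)%N].
  apply: (IHm (n - e)%N).
  - rewrite map_inj_in_uniq ?filter_uniq // => F G.
    rewrite !mem_filter => /andP[pF _] /andP[pG _] eqFG.
    by rewrite -(divpK pF) eqFG divpK.
  - move=> G /s1P pGs; have [mG nG sG] := Ps _ pGs.
    have mG' : G \is monic by rewrite -(monicMl _ mp).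
    split=> //; last by apply: smooth_dvd sG; apply: dvdp_mull.
    by rewrite ltn_subLR // -size_pM ?monic_neq0.
  - move=> F G /s1P pFs /s1P pGs.
    have [->|FG0] := eqVneq (F - G) 0; first by rewrite size_poly0.
    by rewrite leq_subRL // -size_pM // mulrBr ds.
  - rewrite -ltnS (leq_trans _ ltnm) // ltnS ltn_subrL e_gt0 /=.
    exact: leq_trans e_gt0 len.
exists ([seq p * G | G <- t1] ++ t2); split.
- rewrite cat_uniq ut2 map_inj_uniq ?ut1 /= ?andbT; last exact: mulfI.
  (* The union is disjoint: elements of [t2] are smooth for the tail, which omits [p], so none is a
     multiple of [p]. *)
  apply/hasPn => T Tt2; apply/mapP => -[G _ eT].
  have [_ _ sT] := Pt2 T Tt2.
  by move/negP: pL; apply; apply: sT => //; rewrite eT dvdp_mulr.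
- move=> T; rewrite mem_cat => /orP[/mapP[G Gt ->]|Tt].
    have [mG sG smG] := Pt1 G Gt; split.
    + by rewrite monicMl.
    + by rewrite size_pM ?monic_neq0 // sG addnS subnKC.
    + move=> P mP iP /(irreducible_dvd_mul iP)/orP[Pp|PG].
        by rewrite (monic_irreducible_dvd_eq mP mp iP ip Pp) mem_head.
      exact: smG.
  have [mT sT smT] := Pt2 T Tt; split=> // P mP iP PT.
  by rewrite inE smT ?orbT.
- by rewrite size_s size_cat (size_map _ t1) leq_add.
Qed.

Theorem proposition2p5 (K : finFieldType) (N : nat) (hN : (2 <= N)%N)
    (A : {poly_N.+1 K}) (hA : A \in monic_deg K N)
    (h d : nat) (hh : (h <= N - 1)%N) :
  (#|[set F in monic_deg K N |
        (size (polyn F - polyn A)%R <= h.+1)%N && (Pplus (polyn F) <= d)%N]|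
   <= #|[set F in monic_deg K h.+1 | (Pplus (polyn F) <= d)%N]|)%N.
Proof.
pose ge_size (P Q : {poly K}) := (size Q <= size P)%N.
(* All primes of degree at most [d]; smoothness for this list is the condition on [Pplus]. *)
pose L := sort ge_size [seq polyn P | P <- enum {poly_d.+1 K}
                          & (polyn P \is monic) && irreducibleb (polyn P)].
have memL P : reflect [/\ P \is monic, irreducible_poly P & (size P <= d.+1)%N]
    (P \in L).
  rewrite mem_sort; apply: (iffP mapP) => [[Q]|[mP iP sP]].
    rewrite mem_filter => /andP[/andP[mQ /irreducibleP iQ] _] ->.
    by split=> //; apply: size_npoly.
  exists (NPoly sP) => //; rewrite mem_filter mem_enum andbT /= mP.
  exact/irreducibleP.
have smoothP F : F \is monic -> (Pplus F <= d)%N <-> smooth L F.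
  move=> mF; apply: iff_trans (Pplus_leP _ (monic_neq0 mF)) _.
  split=> sF P mP iP PF.
    by apply/memL; split=> //; rewrite -add1n -leq_subLR subn1 sF.
  have /memL[_ _ sP] := sF P mP iP PF.
  by rewrite -subn1 leq_subLR add1n.
set S := [set F in _ | _ && _]; set T := [set F in _ | _].
have PS F : F \in S -> [/\ polyn F \is monic, size F = N.+1,
    (size (polyn F - polyn A)%R <= h.+1)%N & (Pplus (polyn F) <= d)%N].
  by rewrite !inE => /andP[/andP[? /eqP ?] /andP[]].
(* Degree at most [h] is size at most [h.+1], so the interval has dimension [h.+1]; the bound on [h]
   makes this at most [N]. *)
have [|||||||t [ut Pt]] :=
  @smooth_interval_bound K L h.+1 [seq polyn F | F <- enum S].
- rewrite sort_uniq map_inj_uniq; last exact: val_inj.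
  by apply/filter_uniq/enum_uniq.
- by apply: sort_sorted => P Q; apply: leq_total.
- by move=> P /memL[].
- move=> P Q /memL[_ _ sP] mQ iQ /ltnW ltQP.
  by apply/memL; split=> //; apply: leq_trans ltQP sP.
- by rewrite map_inj_uniq ?enum_uniq //; apply: val_inj.
- move=> _ /mapP[F + ->]; rewrite mem_enum => /PS[mF sF _ PF].
  split=> //; last exact/smoothP.
  by rewrite sF ltnS (leq_ltn_trans hh) // subn1 ltn_predL ltnW.
- move=> _ _ /mapP[F + ->] /mapP[G + ->].
  rewrite !mem_enum => /PS[_ _ FA _] /PS[_ _ GA _].
  have -> : polyn F - polyn G = (polyn F - polyn A) - (polyn G - polyn A).
    by rewrite opprB addrA subrK.
  by rewrite (leq_trans (size_polyD _ _)) // geq_max size_polyN FA.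
rewrite size_map -cardE => /leq_trans; apply.
(* The elements of [t] are plain polynomials; they embed into the image of the finite set [T] under
   [polyn]. *)
rewrite cardE -(size_map (@polyn K h.+2)); apply: uniq_leq_size => // F.
move=> /Pt[mF sF smF].
have leF : (size F <= h.+2)%N by rewrite sF.
apply/mapP; exists (NPoly leF) => //; rewrite mem_enum !inE /= mF sF eqxx /=.
exact/smoothP.
Qed.
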